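(* Let $k,l\ge 0$ be integers with $2k+l\ge 1$. Let $\lambda_1,\dots,\lambda_k,\mu_1,\dots,\mu_k,\gamma_1,\dots,\gamma_l$ be real numbers with $\mu_j\neq 0$ for all $j$, such that the $2k+l$ complex numbers $\lambda_1\pm\mu_1 i,\ \dots,\ \lambda_k\pm\mu_k i,\ \gamma_1,\dots,\gamma_l$ are distinct. Let $G$ be a (directed or undirected) loopless graph on the $2k+l$ vertices $1,\dots,2k+l$ which has a matching of size at least $k$. Then there is a real $(2k+l)\times(2k+l)$ matrix whose eigenvalues are $\lambda_1\pm\mu_1 i,\dots,\lambda_k\pm\mu_k i,\gamma_1,\dots,\gamma_l$ and whose graph is $G$.
   Context: A directed graph is a pair $G=(V,E)$ with $E\subseteq V\times V$; it is loopless if $u\ne v$ for every $(u,v)\in E$. Write $u\to v$ if $(u,v)\in E$; both $(u,v)$ and $(v,u)$ may belong to $E$. An undirected graph is identified with a directed graph in which $(u,v)\in E$ if and only if $(v,u)\in E$. All graphs are loopless. A directed graph has a matching of size $k$ if $E$ contains $k$ pairwise vertex-disjoint edges $(u_1,v_1),\dots,(u_k,v_k)$ together with their reverses $(v_1,u_1),\dots,(v_k,u_k)$. For an undirected graph this means $k$ pairwise vertex-disjoint edges $\{u_1,v_1\},\dots,\{u_k,v_k\}$. A loopless graph $G$ on vertices $1,\dots,n$ is the graph of a matrix $A\in\mathbb{R}^{n\times n}$ if for all $i\neq j$: $A_{i,j}\ne 0$ if and only if $i\to j$ in $G$. The diagonal entries of $A$ may be zero or nonzero. *)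

(* Defs.v *)
From mathcomp Require Import all_boot all_order all_algebra.
From mathcomp Require Import complex.
From mathcomp Require Import reals.

Set Implicit Arguments.
Unset Strict Implicit.
Unset Printing Implicit Defensive.

Import GRing.Theory Num.Theory.

Local Open Scope ring_scope.

(* A directed graph on T is its edge relation; an undirected graph is the
   special case of a symmetric relation. *)
Definition loopless (T : finType) (G : rel T) : Prop := irreflexive G.

(* m pairwise vertex-disjoint edges of G whose reverses are also edges. *)
Definition has_matching (T : finType) (G : rel T) (m : nat) : Prop :=
  exists u v : 'I_m -> T,
    (forall i, G (u i) (v i) /\ G (v i) (u i)) /\
    (forall i j, i != j -> [disjoint [set u i; v i] & [set u j; v j]]).

Definition is_graph_of (R : realType) (n : nat) (G : rel 'I_n) (A : 'M[R]_n) :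
    Prop :=
  forall i j : 'I_n, i != j -> (A i j != 0 <-> G i j).

Definition prescribed_spectrum (R : realType) (k l : nat)
    (lambda mu : 'I_k -> R) (gamma : 'I_l -> R) : seq R[i] :=
  [seq (lambda j +i* mu j)%C | j : 'I_k] ++
  [seq (lambda j -i* mu j)%C | j : 'I_k] ++
  [seq (gamma j)%:C%C | j : 'I_l].

(* The (complex) eigenvalues of the real matrix A are exactly the members of s.
   This is equality of sets; it also determines the multiplicities when s
   consists of n distinct numbers. *)
Definition has_eigenvalues (R : realType) (n : nat) (A : 'M[R]_n)
    (s : seq R[i]) : Prop :=
  forall z : R[i], eigenvalue (map_mx (real_complex R) A) z <-> z \in s.

(* Main.v *)
(* Put blocks [[a, b], [-b, a]] (eigenvalues a +- i b) on the edges of a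
   matching, the remaining diagonal entries on the unmatched vertices, and a
   parameter e at all other edges of G.  At e = 0 the vector p of block entries
   can be chosen to give the prescribed spectrum.  For small e > 0 the entries p
   are corrected so as to keep the spectrum: with s_x the wanted eigenvalues, the
   simplified Newton map eig_x(p) |-> eig_x(p) + det (s_x - B(e, p)) / c_x has
   zero strict derivative in p at (e, p) = (0, p0), because
   det (s_x - B(0, p)) = prod_y (s_x - eig_y(p)) and
   c_x = prod_(y != x) (s_x - s_y).  It is thus a contraction near p0, and its
   fixed point makes every s_x an eigenvalue. *)
Require Import Defs.
From HB Require Import structures.
From mathcomp Require Import all_boot all_order all_algebra.
From mathcomp Require Import perm complex.
From mathcomp Require Import boolp classical_sets functions reals.
From mathcomp Require Import interval_inference topology normedtype sequences.
From mathcomp Require Import ring lra.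

Set Implicit Arguments.
Unset Strict Implicit.
Unset Printing Implicit Defensive.

Import Order.TTheory GRing.Theory Num.Theory.
Import numFieldNormedType.Exports.
Import Normc.

Local Open Scope ring_scope.

(** * The real-valued modulus on complex numbers *)

Section NormC.
Variable R : realType.
Implicit Types z w : R[i].

Arguments normc : simpl never.

Lemma normc_ge0 z : 0 <= normc z.
Proof. by case: z => a b; exact: sqrtr_ge0. Qed.

Lemma normc_0 : normc (0 : R[i]) = 0.
Proof. exact: normc0. Qed.

Lemma ler_normcD z w : normc (z + w) <= normc z + normc w.
Proof. exact: le_normcD. Qed.

Lemma normc_real (x : R) : normc (x%:C)%C = `|x|.
Proof. by rewrite /normc /= expr0n addr0 sqrtr_sqr. Qed.

Lemma normRe_le z : `|complex.Re z| <= normc z.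
Proof.
by case: z => a b; rewrite /normc /= -sqrtr_sqr ler_wsqrtr // lerDl sqr_ge0.
Qed.

Lemma normIm_le z : `|complex.Im z| <= normc z.
Proof.
by case: z => a b; rewrite /normc /= -sqrtr_sqr ler_wsqrtr // lerDr sqr_ge0.
Qed.

End NormC.

(* The library has both structures on matrices, but not their join. *)
HB.instance Definition _ (R : realType) (m n : nat) :=
  Complete.on 'M[R]_(m, n).

(** * Calculus of strict derivatives and the contraction argument *)

Section StrictDiff.
Context {R : realType} {n : nat}.
Variable p0 : 'rV[R]_n.
Local Notation C := R[i].
Local Notation V := 'rV[R]_n.
Implicit Types (f g : R -> V -> C) (a b : C) (l m : V -> C).

Local Open Scope classical_set_scope.

(* Value [a] and strict derivative [l] in [p] at [(e, p) = (0, p0)], uniformly in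
   the parameter [e]; [l] is only required to be bounded, not linear. *)
Definition strict_diff f a l : Prop :=
  (exists2 K : R, 0 <= K & forall v, normc (l v) <= K * `|v|) /\
  forall eta : R, 0 < eta -> \forall r \near (0 : R)^'+,
    forall e p q, `|e| <= r -> `|p - p0| <= r -> `|q - p0| <= r ->
    normc (f e p - a) <= eta /\
    normc (f e p - f e q - l (p - q)) <= eta * `|p - q|.

Lemma strict_diff_ext f g a b l m :
  strict_diff f a l -> (forall e p, f e p = g e p) -> a = b ->
  (forall v, l v = m v) -> strict_diff g b m.
Proof.
move=> [Kl fl] fg <- lm.
have -> : g = f by apply/funext => e; apply/funext => p; rewrite fg.
by have -> : m = l by apply/funext => v; rewrite lm.
Qed.

Lemma strict_diff_cst a : strict_diff (fun _ _ => a) a (fun=> 0).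
Proof.
split; first by exists 0 => // v; rewrite normc_0 mul0r.
move=> eta eta0; apply: nearW => r e p q _ _ _.
by rewrite !subrr normc_0 ltW // mulr_ge0 // ltW.
Qed.

Lemma strict_diff_param : strict_diff (fun e _ => (e%:C)%C) 0 (fun=> 0).
Proof.
split; first by exists 0 => // v; rewrite normc_0 mul0r.
move=> eta eta0; near=> r => e p q er _ _; split; last first.
  by rewrite !subrr normc_0 mulr_ge0 // ltW.
rewrite subr0 normc_real (le_trans er) //.
by near: r; exact: nbhs_right_le.
Unshelve. all: by end_near. Qed.

Lemma mx_entry_le_norm (v : V) x : `|v ord0 x| <= `|v|.
Proof.
rewrite [leRHS]/Num.Def.normr /= mx_normrE.
by apply/bigmax_geP; right => /=; exists (ord0, x).
Qed.

Lemma strict_diff_coord x :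
  strict_diff (fun _ p => ((p ord0 x)%:C)%C) ((p0 ord0 x)%:C)%C
              (fun v => ((v ord0 x)%:C)%C).
Proof.
split; first by exists 1 => // v; rewrite mul1r normc_real mx_entry_le_norm.
move=> eta eta0; near=> r => e p q _ pr _; split; last first.
  by rewrite !mxE rmorphB subrr normc_0 mulr_ge0 // ltW.
rewrite -rmorphB normc_real (_ : _ - _ = (p - p0) ord0 x); last by rewrite !mxE.
rewrite (le_trans (mx_entry_le_norm _ _)) // (le_trans pr) //.
by near: r; exact: nbhs_right_le.
Unshelve. all: by end_near. Qed.

Lemma strict_diffD f g a b l m : strict_diff f a l -> strict_diff g b m ->
  strict_diff (fun e p => f e p + g e p) (a + b) (fun v => l v + m v).
Proof.
move=> [[K K0 lK] fl] [[L L0 mL] gm]; split.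
  exists (K + L); first exact: addr_ge0.
  move=> v; rewrite mulrDl; apply: le_trans (ler_normcD _ _) _.
  exact: lerD.
move=> eta eta0; have eta2 : 0 < eta / 2 by rewrite divr_gt0.
apply: filterS2 (fl _ eta2) (gm _ eta2) => r fr gr e p q er pr qr.
have [f1 f2] := fr _ _ _ er pr qr.
have [g1 g2] := gr _ _ _ er pr qr.
split.
  rewrite (_ : _ - _ = (f e p - a) + (g e p - b)); last by ring.
  by apply: le_trans (ler_normcD _ _) _; rewrite (splitr eta) lerD.
rewrite (_ : _ - _ - _ = (f e p - f e q - l (p - q)) +
                         (g e p - g e q - m (p - q))); last by ring.
by apply: le_trans (ler_normcD _ _) _; rewrite (splitr eta) mulrDl lerD.
Qed.

Lemma strict_diffM f g a b l m : strict_diff f a l -> strict_diff g b m ->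
  strict_diff (fun e p => f e p * g e p) (a * b) (fun v => a * m v + b * l v).
Proof.
move=> [[K K0 lK] fl] [[L L0 mL] gm].
have [na0 nb0] := (normc_ge0 a, normc_ge0 b).
split.
  exists (normc a * L + normc b * K); first by rewrite addr_ge0 ?mulr_ge0.
  move=> v; rewrite mulrDl -!mulrA; apply: le_trans (ler_normcD _ _) _.
  by rewrite !normcM lerD // ler_wpM2l.
move=> eta eta0.
(* [M] is the sum of the coefficients of [eta'] in the four error terms of the last estimate. The
   bound [eta' <= 1] is what allows the crude bounds [K + 1], [L + 1] and [normc b + 1] below. *)
pose M := K + L + 2 + normc a + normc b.
have M0 : 0 < M by rewrite /M; lra.
pose eta' := Num.min 1 (eta / M).
have eta'0 : 0 < eta' by rewrite lt_min ltr01 divr_gt0.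
have eta'1 : eta' <= 1 by rewrite ge_min lexx.
have eta'M : eta' * M <= eta by rewrite -ler_pdivlMr // ge_min lexx orbT.
apply: filterS2 (fl _ eta'0) (gm _ eta'0) => r fr gr e p q er pr qr.
have [f1 f2] := fr _ _ _ er pr qr.
have [g1 g2] := gr _ _ _ er pr qr.
have [g3 _] := gr _ _ _ er qr pr.
set v := p - q in f2 g2 *.
have v0 : 0 <= `|v| := normr_ge0 v.
have Df : normc (f e p - f e q) <= (K + 1) * `|v|.
  rewrite -[f e p - _](subrK (l v)) (le_trans (ler_normcD _ _)) //.
  by have := lK v; nra.
have Dg : normc (g e p - g e q) <= (L + 1) * `|v|.
  rewrite -[g e p - _](subrK (m v)) (le_trans (ler_normcD _ _)) //.
  by have := mL v; nra.
have gp : normc (g e p) <= normc b + 1.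
  by rewrite -[g e p](subrK b) (le_trans (ler_normcD _ _)) //; lra.
split.
  rewrite (_ : _ - _ = (f e p - a) * g e p + a * (g e p - b)); last by ring.
  apply: le_trans (ler_normcD _ _) _; rewrite !normcM.
  have := normc_ge0 (f e p - a); have := normc_ge0 (g e p - b).
  have := normc_ge0 (g e p); rewrite /M in eta'M.
  nra.
(* Each summand is either a factor close to its value at the centre times a Lipschitz increment, or
   a constant times the remainder of one factor. The mixed choice of [f e p] and [g e q] makes the
   sum telescope. *)
rewrite (_ : _ - _ - _ = ((f e p - a) * (g e p - g e q) +
   a * (g e p - g e q - m v)) + ((g e q - b) * (f e p - f e q) +
   b * (f e p - f e q - l v))); last by ring.
apply: le_trans (ler_normcD _ _) _.
apply: le_trans (lerD (ler_normcD _ _) (ler_normcD _ _)) _.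
rewrite !normcM.
apply: (@le_trans _ _ (eta' * M * `|v|)); last exact: ler_wpM2r.
have h1 := ler_pM (normc_ge0 _) (normc_ge0 _) f1 Dg.
have h2 := ler_pM (normc_ge0 _) (normc_ge0 _) g3 Df.
have h3 := ler_wpM2l na0 g2.
have h4 := ler_wpM2l nb0 f2.
rewrite /M; lra.
Qed.

Lemma strict_diffN f a l : strict_diff f a l ->
  strict_diff (fun e p => - f e p) (- a) (fun v => - l v).
Proof.
move=> fl.
apply: strict_diff_ext (strict_diffM (strict_diff_cst (-1)) fl) _ _ _.
- by move=> e p; rewrite mulN1r.
- by rewrite mulN1r.
- by move=> v; rewrite mulN1r mulr0 addr0.
Qed.

Lemma strict_diffB f g a b l m : strict_diff f a l -> strict_diff g b m ->
  strict_diff (fun e p => f e p - g e p) (a - b) (fun v => l v - m v).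
Proof. by move=> fl /strict_diffN; exact: strict_diffD. Qed.

Lemma strict_diffMl c f a l : strict_diff f a l ->
  strict_diff (fun e p => c * f e p) (c * a) (fun v => c * l v).
Proof.
move=> fl.
apply: strict_diff_ext (strict_diffM (strict_diff_cst c) fl) _ _ _ => //.
by move=> v; rewrite mulr0 addr0.
Qed.

(** From here on only the existence of a derivative is recorded: in the Newton map the derivative of
    the determinant cancels against that of its restriction to [e = 0], so its formula never
    matters. *)
Lemma strict_diff_sum (I : Type) (s : seq I) (f : I -> R -> V -> C)
    (a : I -> C) :
  (forall i, exists l, strict_diff (f i) (a i) l) ->
  exists l, strict_diff (fun e p => \sum_(i <- s) f i e p)
                        (\sum_(i <- s) a i) l.
Proof.
move=> fa; elim: s => [|i s [m IH]].
  exists (fun=> 0); apply: strict_diff_ext (strict_diff_cst 0) _ _ _ => //.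
  - by move=> e p; rewrite big_nil.
  - by rewrite big_nil.
have [l il] := fa i; exists (fun v => l v + m v).
apply: strict_diff_ext (strict_diffD il IH) _ _ _ => //.
- by move=> e p; rewrite big_cons.
- by rewrite big_cons.
Qed.

Lemma strict_diff_prod (I : Type) (s : seq I) (P : pred I)
    (f : I -> R -> V -> C) (a : I -> C) :
  (forall i, exists l, strict_diff (f i) (a i) l) ->
  exists l, strict_diff (fun e p => \prod_(i <- s | P i) f i e p)
                        (\prod_(i <- s | P i) a i) l.
Proof.
move=> fa; elim: s => [|i s [m IH]].
  exists (fun=> 0); apply: strict_diff_ext (strict_diff_cst 1) _ _ _ => //.
  - by move=> e p; rewrite big_nil.
  - by rewrite big_nil.
have [l il] := fa i.
have [Pi|nPi] := boolP (P i).
  exists (fun v => a i * m v + (\prod_(i <- s | P i) a i) * l v).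
  apply: strict_diff_ext (strict_diffM il IH) _ _ _ => //.
  - by move=> e p; rewrite big_cons Pi.
  - by rewrite big_cons Pi.
exists m; apply: strict_diff_ext IH _ _ _ => //.
- by move=> e p; rewrite big_cons (negbTE nPi).
- by rewrite big_cons (negbTE nPi).
Qed.

(** By the Leibniz expansion, a determinant is a signed sum of products of entries. *)
Lemma strict_diff_det k (M : R -> V -> 'M[C]_k) (M0 : 'M[C]_k) :
  (forall i j, exists l, strict_diff (fun e p => M e p i j) (M0 i j) l) ->
  exists l, strict_diff (fun e p => \det (M e p)) (\det M0) l.
Proof.
move=> MM0; apply: (@strict_diff_sum {perm 'I_k}) => s.
have [l sl] := strict_diff_prod (index_enum 'I_k) predT (fun i => MM0 i (s i)).
by exists (fun v => (-1) ^+ s * l v); exact: strict_diffMl.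
Qed.

(* Hence [f e p - f 0 p] has strict derivative 0, whatever [l] is. *)
Lemma strict_diff_freeze f a l :
  strict_diff f a l -> strict_diff (fun=> f 0) a l.
Proof.
move=> [Kl fl]; split => // eta eta0.
apply: filterS2 (nbhs_right_gt 0) (fl _ eta0) => r r0 h _ p q _.
by apply: h; rewrite normr0 ltW.
Qed.

(** Strict derivative zero makes the map with components [h x e] a contraction of a small closed
    ball around [p0], and Banach's theorem applies. All small radii [r] are allowed, so that the
    user can keep [p] as close to [p0] as needed; [e] is strictly positive because it becomes a
    nonzero matrix entry. *)
Lemma strict_diff_fixpoint (h : 'I_n -> R -> V -> R) :
  (forall x eta, 0 < eta -> \forall r \near (0 : R)^'+,
    forall e p q, `|e| <= r -> `|p - p0| <= r -> `|q - p0| <= r ->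
    `|h x e p - p0 ord0 x| <= eta /\
    `|h x e p - h x e q| <= eta * `|p - q|) ->
  \forall r \near (0 : R)^'+, exists e p,
    [/\ 0 < e, `|p - p0| <= r & forall x, h x e p = p ord0 x].
Proof.
move=> hsd.
have hsd' eta : 0 < eta -> \forall r \near (0 : R)^'+,
    forall x e p q, `|e| <= r -> `|p - p0| <= r -> `|q - p0| <= r ->
    `|h x e p - p0 ord0 x| <= eta /\
    `|h x e p - h x e q| <= eta * `|p - q|.
  by move=> eta0; apply: filter_forall => x; exact: hsd.
have half0 : 0 < (2^-1 : R) by rewrite invr_gt0.
apply: filterS2 (nbhs_right_gt 0) (hsd' _ half0) => r r0 hr.
have r2 : 0 < r / 2 by rewrite divr_gt0.
(* At radius [r] the hypothesis with [eta = 1/2] gives the Lipschitz constant but bounds the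
   displacement of [p0] only by [1/2]. A second use with [eta = r / 2], at a smaller radius [e],
   bounds it by [r / 2]. Half of [r] plus this displacement keeps the ball stable. *)
have near_e : \forall e \near (0 : R)^'+, [/\ 0 < e, e <= r &
    forall x e' p q, `|e'| <= e -> `|p - p0| <= e -> `|q - p0| <= e ->
    `|h x e' p - p0 ord0 x| <= r / 2 /\
    `|h x e' p - h x e' q| <= r / 2 * `|p - q|].
  by apply: filterS3 (nbhs_right_gt 0) (nbhs_right_le r0) (hsd' _ r2).
have [e [e0 er he]] := filter_ex near_e.
have e_r : `|e| <= r by rewrite gtr0_norm.
have p0r : `|p0 - p0| <= r by rewrite subrr normr0 ltW.
pose T (p : V) : V := \row_x h x e p.
have TL p q : `|p - p0| <= r -> `|q - p0| <= r ->
    `|T p - T q| <= 2^-1 * `|p - q|.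
  move=> pr qr; rewrite [leLHS]/Num.Def.normr/= mx_normrE bigmax_le//=.
  by move=> -[i x] _ /=; rewrite !mxE; have [] := hr x e p q e_r pr qr.
have T0 : `|T p0 - p0| <= r / 2.
  rewrite [leLHS]/Num.Def.normr/= mx_normrE bigmax_le//=.
    by rewrite divr_ge0 // ltW.
  move=> -[i x] _ /=; rewrite !mxE ord1; apply: (he x e p0 p0 _ _ _).1.
  - by rewrite gtr0_norm.
  - by rewrite subrr normr0 ltW.
  - by rewrite subrr normr0 ltW.
pose U := [set p : V | `|p - p0| <= r].
have TU : set_fun U U T.
  move=> p pU; rewrite /U /= -[T p](subrK (T p0)) -addrA.
  apply: le_trans (ler_normD _ _) _.
  have := TL _ _ pU p0r; rewrite /U /= in pU; lra.
have [|||p pU Tp] := @banach_fixed_point R _ U (mkfun_fun TU).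
- exists 2^-1%:nng; split; first by rewrite /= invf_lt1 // ltr1n.
  by move=> -[p q] [pU qU]; exact: TL.
- rewrite (_ : U = closed_ball_ Num.norm p0 r).
    exact: closed_closed_ball_.
  by apply/seteqP; split=> p; rewrite /U /closed_ball_ /= distrC.
- by exists p0.
- exists e, p; split=> // x.
  by rewrite [in RHS]Tp /= mxE.
Qed.

End StrictDiff.

(** * Eigenvalues as roots of the characteristic polynomial *)

Section EigenChar.
Variables (F : fieldType) (n : nat).

Lemma eigenvalue_det (A : 'M[F]_n) z :
  eigenvalue A z = (\det (z%:M - A) == 0).
Proof.
rewrite eigenvalue_root_char /root /char_poly -[_.[z]]/(horner_eval z _).
rewrite -det_map_mx; congr (\det _ == 0); apply/matrixP => i j.
by rewrite !mxE /= /horner_eval hornerD hornerN hornerC hornerMn hornerX.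
Qed.

(** A further eigenvalue would give [n + 1] distinct roots of the characteristic polynomial, which
    has degree [n]. *)
Lemma eigenvalue_codom (A : 'M[F]_n) (s : 'I_n -> F) : injective s ->
  (forall x, eigenvalue A (s x)) -> forall z, eigenvalue A z <-> z \in codom s.
Proof.
move=> s_inj sA z; split; last by case/codomP => x ->.
apply: contraTT => zs; apply/negP => zA.
have : (size (z :: codom s) < size (char_poly A))%N.
  apply: max_poly_roots; first exact/monic_neq0/char_poly_monic.
    rewrite /= -eigenvalue_root_char zA; apply/allP => _ /codomP[x ->].
    by rewrite -eigenvalue_root_char.
  by rewrite /= zs map_inj_uniq // enum_uniq.
by rewrite size_char_poly /= size_codom card_ord ltnn.
Qed.

End EigenChar.

(** * Block matrices along an involution and their explicit diagonalisation *)

(* [tau] exchanges the ends of each matching edge and fixes the unmatched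
   vertices; [second] marks one end of each edge.  A pair [x], [tau x] with [x]
   not marked carries the block [[p x, p (tau x)], [- p (tau x), p x]]. *)
Section PairedMatrix.
Context {R : realType} {n : nat}.
Variables (tau : 'I_n -> 'I_n) (second : pred 'I_n) (G : rel 'I_n).
Hypothesis tauK : involutive tau.
Hypothesis second_tau : forall x, tau x != x -> second (tau x) = ~~ second x.
Hypothesis second_fix : forall x, tau x = x -> ~~ second x.
Local Notation C := R[i].
Local Notation V := 'rV[R]_n.
Local Notation rc := (real_complex R).
Local Notation im := ('i%C : C).
Implicit Types (p q : V) (x y : 'I_n).

Definition paired_eig p x : C :=
  if second x then rc (p ord0 (tau x)) - im * rc (p ord0 x)
  else if tau x == x then rc (p ord0 x)
  else rc (p ord0 x) + im * rc (p ord0 (tau x)).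

Definition paired_mx (e : R) p : 'M[R]_n := \matrix_(x, y)
  if x == y then (if second x then p ord0 (tau x) else p ord0 x)
  else if y == tau x then (if second x then - p ord0 x else p ord0 y)
  else if G x y then e else 0.

(* The rows are left eigenvectors of [paired_mx 0 p], for every [p]. *)
Definition paired_eigvec : 'M[C]_n := \matrix_(x, y)
  if y == x then (if second x then im else 1)
  else if y == tau x then (if second x then 1 else - im) else 0.

Lemma second_neq x : second x -> tau x != x.
Proof. by apply: contraL => /eqP /second_fix. Qed.

(** Used to expand matrix products: row [x] of [paired_eigvec] is supported on [x] and [tau x]. *)
Lemma paired_sum x (F : 'I_n -> C) :
  (forall y, y != x -> y != tau x -> F y = 0) ->
  \sum_y F y = if tau x == x then F x else F x + F (tau x).
Proof.
move=> F0; rewrite (bigD1 x) //=; have [xx|xx] := eqVneq (tau x) x.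
  by rewrite big1 ?addr0 // => y yx; apply: F0 => //; rewrite xx.
rewrite (bigD1 (tau x)) //= big1 ?addr0 // => y /andP[yx ytx].
exact: F0.
Qed.

Lemma imim : im * im = -1.
Proof. by rewrite -expr2 sqr_i. Qed.

Lemma conj_im : im^*%C = - im.
Proof. by apply/eqP; rewrite eq_complex /= oppr0 !eqxx. Qed.

Lemma conj_cartesian (a b : R) :
  (rc a + im * rc b)^*%C = rc a - im * rc b.
Proof.
by apply/eqP; rewrite eq_complex /=; apply/andP; split; apply/eqP; ring.
Qed.

Lemma conj_Nim : (- im)^*%C = im.
Proof. by rewrite -conj_im conjcK. Qed.

Lemma paired_eigvec_diag x :
  paired_eigvec x x = if second x then im else 1.
Proof. by rewrite mxE eqxx. Qed.

Lemma paired_eigvec_tau x : tau x != x ->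
  paired_eigvec x (tau x) = if second x then 1 else - im.
Proof. by move=> /negbTE xx; rewrite mxE xx eqxx. Qed.

Lemma paired_eigvec_tauC x : tau x != x ->
  paired_eigvec (tau x) x = if second x then - im else 1.
Proof.
move=> xx; rewrite -[X in paired_eigvec _ X]tauK paired_eigvec_tau.
  by rewrite second_tau //; case: (second x).
by rewrite tauK eq_sym.
Qed.

Lemma paired_eigvec_off x y : y != x -> y != tau x -> paired_eigvec x y = 0.
Proof. by move=> /negbTE yx /negbTE ytx; rewrite mxE yx ytx. Qed.

Lemma tau_neq x y : y != tau x -> x != tau y.
Proof. by apply: contra => /eqP ->; rewrite tauK. Qed.

(** The rows are orthogonal for the Hermitian product: multiplying by the conjugate transpose [Q']
    gives a diagonal matrix of squared norms, 1 at fixed points of [tau] and 2 elsewhere. *)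
Lemma paired_eigvec_det : \det paired_eigvec != 0.
Proof.
pose Q' : 'M[C]_n := \matrix_(y, z) (paired_eigvec z y)^*%C.
have QQ' : paired_eigvec *m Q' =
    diag_mx (\row_x (if tau x == x then 1 else 2)).
  apply/matrixP => x z; rewrite mxE (@paired_sum x); last first.
    by move=> y yx ytx; rewrite paired_eigvec_off // mul0r.
  rewrite 2![Q' _ _]mxE [RHS]mxE [X in X *+ _]mxE paired_eigvec_diag.
  have [->{z}|zx] := eqVneq z x.
    rewrite paired_eigvec_diag mulr1n; case: eqVneq => [xx|xx].
      by rewrite (negbTE (second_fix xx)) mul1r conjc1.
    rewrite paired_eigvec_tau //; case: (second x).
      by rewrite conj_im conjc1 mulrN imim opprK mul1r.
    by rewrite conj_Nim conjc1 mulNr imim mul1r opprK.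
  rewrite mulr0n.
  have [zt|ztx] := eqVneq z (tau x); last first.
    rewrite (@paired_eigvec_off z x) ?(@paired_eigvec_off z (tau x)).
    + by rewrite conjc0 !mulr0 addr0 if_same.
    + by rewrite eq_sym.
    + by rewrite (inj_eq (can_inj tauK)) eq_sym.
    + by rewrite eq_sym.
    + exact: tau_neq.
  rewrite zt in zx *; rewrite (negbTE zx) paired_eigvec_diag second_tau //.
  rewrite paired_eigvec_tauC // paired_eigvec_tau // if_neg; case: (second x).
    by rewrite conj_Nim imim conjc1 mulr1 addNr.
  by rewrite conjc1 mulr1 conj_im mulrNN imim subrr.
have : \det (paired_eigvec *m Q') != 0.
  rewrite QQ' det_diag; apply/prodf_neq0 => x _; rewrite mxE.
  by case: ifP => _; rewrite ?oner_eq0 // pnatr_eq0.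
by rewrite det_mulmx mulf_eq0 negb_or => /andP[].
Qed.

Lemma paired_mx0E p x y : paired_mx 0 p x y =
  if x == y then (if second x then p ord0 (tau x) else p ord0 x)
  else if y == tau x then (if second x then - p ord0 x else p ord0 y) else 0.
Proof. by rewrite mxE if_same. Qed.

Lemma paired_eigvecP p :
  paired_eigvec *m map_mx rc (paired_mx 0 p) =
  diag_mx (\row_x paired_eig p x) *m paired_eigvec.
Proof.
rewrite mul_diag_mx; apply/matrixP => x z.
rewrite [LHS]mxE (@paired_sum x); last first.
  by move=> y yx ytx; rewrite paired_eigvec_off // mul0r.
rewrite [RHS]mxE [(\row__ _) _ _]mxE.
have mapE y : map_mx rc (paired_mx 0 p) y z = rc (paired_mx 0 p y z).
  by rewrite mxE.
rewrite !mapE {mapE} !paired_mx0E tauK.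
rewrite paired_eigvec_diag /paired_eig.
have [->{z}|zx] := eqVneq z x.
  rewrite paired_eigvec_diag; have [xx|xx] := eqVneq (tau x) x.
    by rewrite (negbTE (second_fix xx)) mulrC.
  rewrite paired_eigvec_tau // second_tau //; case: (second x) => /=.
    by rewrite mulrBl mulrAC imim mulN1r opprK mul1r [im * _]mulrC.
  by rewrite rmorphN mulrNN mulr1 mul1r.
have [zt|ztx] := eqVneq z (tau x).
  rewrite zt in zx *; rewrite (negbTE zx) paired_eigvec_tau // second_tau //.
  case: (second x) => /=.
    by rewrite rmorphN mulrN !mul1r mulr1 addrC.
  by rewrite mulrN mulrDl mulrAC imim mulN1r opprB mul1r mulNr [im * _]mulrC.
by rewrite (paired_eigvec_off zx ztx) rmorph0 !mulr0 addr0 if_same.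
Qed.

(** The eigenvector matrix is invertible and independent of [p], so the factorisation holds for
    every [p], even where eigenvalues coincide. *)
Lemma paired_det p (z : C) :
  \det (z%:M - map_mx rc (paired_mx 0 p)) = \prod_x (z - paired_eig p x).
Proof.
apply: (mulfI paired_eigvec_det).
rewrite -det_mulmx mulmxBr paired_eigvecP scalar_mxC -mulmxBl det_mulmx mulrC.
congr (_ * _); rewrite -diag_const_mx -raddfB det_diag.
by apply: eq_bigr => x _; rewrite !mxE.
Qed.

Lemma paired_eig_conj p x : (paired_eig p x)^*%C = paired_eig p (tau x).
Proof.
rewrite /paired_eig tauK [tau x == x]eq_sym.
have [xx|xx] := eqVneq x (tau x).
  by rewrite -xx (negbTE (second_fix (esym xx))) conjc_real.
rewrite second_tau 1?eq_sym // if_neg.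
by case: (second x); rewrite -conj_cartesian ?conjcK.
Qed.

Lemma det_conj (z : C) (A : 'M[R]_n) :
  (\det (z%:M - map_mx rc A))^*%C = \det (z^*%C%:M - map_mx rc A).
Proof.
rewrite -[LHS]/((@conjc R) _) -det_map_mx map_mxB map_scalar_mx -map_mx_comp.
by congr (\det (_ - _)); apply/matrixP => i j; rewrite !mxE; exact: conjc_real.
Qed.

End PairedMatrix.

(** * Correcting the block entries to keep the spectrum when [e > 0] *)

Section PairedSpectrum.
Context {R : realType} {n : nat}.
Variables (tau : 'I_n -> 'I_n) (second : pred 'I_n) (G : rel 'I_n).
Hypothesis tauK : involutive tau.
Hypothesis second_tau : forall x, tau x != x -> second (tau x) = ~~ second x.
Hypothesis second_fix : forall x, tau x = x -> ~~ second x.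
Variable p0 : 'rV[R]_n.
Hypothesis p0_second : forall x, second x -> p0 ord0 x != 0.
Hypothesis p0_inj : injective (paired_eig tau second p0).
Hypothesis G_tau : forall x, tau x != x -> G x (tau x).
Local Notation C := R[i].
Local Notation V := 'rV[R]_n.
Local Notation rc := (real_complex R).
Local Notation im := ('i%C : C).
Local Notation eig := (paired_eig tau second).
Local Notation B := (paired_mx tau second G).
Local Notation s := (eig p0).
Implicit Types (p q : V) (x y : 'I_n).

Local Open Scope classical_set_scope.

(** Each [eig p x] is real-linear in [p], hence its own derivative. *)
Lemma strict_diff_eig x :
  strict_diff p0 (fun _ p => eig p x) (s x) (fun v => eig v x).
Proof.
have X y := strict_diff_coord p0 y.
rewrite /paired_eig; case: (second x) => //.
  by apply: strict_diffB => //; exact: strict_diffMl.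
case: (tau x == x) => //.
by apply: strict_diffD => //; exact: strict_diffMl.
Qed.

Let c x := \prod_(y | y != x) (s x - s y).
Let g x e p := \det ((s x)%:M - map_mx rc (B e p)).

(** Every entry of [B e p] is a constant, the parameter [e], or a coordinate of [p] up to sign. *)
Lemma strict_diff_char x :
  exists l, strict_diff p0 (g x) (\det ((s x)%:M - map_mx rc (B 0 p0))) l.
Proof.
apply: strict_diff_det => i j.
have X y := strict_diff_coord p0 y.
suff [l Bl] : exists l, strict_diff p0 (fun e p => rc (B e p i j))
                                       (rc (B 0 p0 i j)) l.
  exists (fun v => 0 - l v).
  apply: strict_diff_ext
    (strict_diffB (strict_diff_cst p0 ((s x)%:M i j)) Bl) _ _ _ => //.
  - by move=> e p; rewrite !mxE.
  - by rewrite !mxE.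
case ij : (i == j).
  case si : (second i).
    by eexists; apply: strict_diff_ext (X (tau i)) _ _ _ => [e p||v];
       rewrite ?mxE ?ij ?si.
  by eexists; apply: strict_diff_ext (X i) _ _ _ => [e p||v];
     rewrite ?mxE ?ij ?si.
case jt : (j == tau i).
  case si : (second i).
    by eexists; apply: strict_diff_ext (strict_diffN (X i)) _ _ _ => [e p||v];
       rewrite ?mxE ?ij ?jt ?si ?rmorphN.
  by eexists; apply: strict_diff_ext (X j) _ _ _ => [e p||v];
     rewrite ?mxE ?ij ?jt ?si.
case Gij : (G i j).
  by eexists; apply: strict_diff_ext (strict_diff_param p0) _ _ _ => [e p||v];
     rewrite ?mxE ?ij ?jt ?Gij.
by eexists; apply: strict_diff_ext (strict_diff_cst p0 0) _ _ _ => [e p||v];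
   rewrite ?mxE ?ij ?jt ?Gij.
Qed.

Lemma c_neq0 x : c x != 0.
Proof.
apply/prodf_neq0 => y yx; rewrite subr_eq0.
by apply: contra yx => /eqP /p0_inj ->.
Qed.

(* At [e = 0], [p = p0] the correction vanishes, and its derivative cancels that
   of [eig p x]. *)
Let H x e p := eig p x + (c x)^-1 * g x e p.

(** Split [g x e p] into its change from [e = 0], of derivative zero, and [g x 0 p], which factors
    as [s x - eig p x] times the remaining product. The first factor vanishes at [p0], so the
    product rule leaves only [- c x * eig v x]; after division by [c x] this cancels the derivative
    of [eig p x]. *)
Lemma strict_diff_newton x : strict_diff p0 (H x) (s x) (fun=> 0).
Proof.
have [l gl] := strict_diff_char x.
have [m hm] : exists m, strict_diff p0
    (fun _ p => \prod_(y | y != x) (s x - eig p y)) (c x) m.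
  apply: strict_diff_prod => y; eexists.
  exact: strict_diffB (strict_diff_cst p0 (s x)) (strict_diff_eig y).
have dx := strict_diff_eig x.
have fx := strict_diffM (strict_diffB (strict_diff_cst p0 (s x)) dx) hm.
have g0 := strict_diffB gl (strict_diff_freeze gl).
apply: strict_diff_ext
  (strict_diffD dx (strict_diffMl (c x)^-1 (strict_diffD g0 fx))) _ _ _.
- move=> e p; rewrite /H; congr (_ + _ * _).
  rewrite {2}/g paired_det // (bigD1 x) //=.
  by rewrite subrK.
- by rewrite !subrr mul0r addr0 mulr0 addr0.
- move=> v; rewrite /= !subrr mul0r !add0r mulrN mulrN mulKf ?subrr //.
  exact: c_neq0.
Qed.

Lemma exists_paired_spectrum : exists A : 'M[R]_n,
  (forall z, eigenvalue (map_mx rc A) z <-> z \in codom s) /\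
  is_graph_of G A.
Proof.
(* One real equation per coordinate of [p]: [p x] is the real part of [eig p x] at an unmarked [x],
   and the imaginary part of the eigenvalue at the unmarked partner of a marked [x]. *)
pose h x e p := if second x then complex.Im (H (tau x) e p)
                else complex.Re (H x e p).
have Res x : ~~ second x -> forall p, complex.Re (eig p x) = p ord0 x.
  move=> /negbTE sx p; rewrite /paired_eig sx.
  by case: (tau x == x) => //=; ring.
have Ims x : second x -> forall p, complex.Im (eig p (tau x)) = p ord0 x.
  move=> sx p; have xx := second_neq second_fix sx.
  rewrite /paired_eig second_tau // sx tauK [x == _]eq_sym (negbTE xx) /=.
  ring.
have near_h x eta : 0 < eta -> \forall r \near (0 : R)^'+,
    forall e p q, `|e| <= r -> `|p - p0| <= r -> `|q - p0| <= r ->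
    `|h x e p - p0 ord0 x| <= eta /\
    `|h x e p - h x e q| <= eta * `|p - q|.
  move=> eta0.
  have [_ Hx] := strict_diff_newton (if second x then tau x else x).
  apply: filterS (Hx _ eta0) => r hr e p q er pr qr.
  have {hr}[h1 h2] := hr e p q er pr qr; rewrite subr0 in h2.
  rewrite /h; case: ifPn h1 h2 => sx h1 h2.
    rewrite -(Ims _ sx p0) -!raddfB; split; exact: le_trans (normIm_le _) _.
  rewrite -(Res _ sx p0) -!raddfB; split; exact: le_trans (normRe_le _) _.
(* Such a radius keeps the off-diagonal block entries of the corrected [p] away from zero, so that
   the matching edges remain edges of the graph of the matrix. *)
have near_p0 : \forall r \near (0 : R)^'+,
    forall x, second x -> r < `|p0 ord0 x|.
  apply: filter_forall => x; case: (boolP (second x)) => sx; last exact: nearW.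
  have px : 0 < `|p0 ord0 x| by rewrite normr_gt0 p0_second.
  by apply: filterS (nbhs_right_lt px).
have [r [rp0 [e [p [e0 pr hp]]]]] :=
  filter_ex (filterI near_p0 (strict_diff_fixpoint near_h)).
exists (B e p).
have p_second x : second x -> p ord0 x != 0.
  move=> sx; apply: contraTneq (rp0 x sx) => px; rewrite -leNgt.
  apply: le_trans pr; apply: le_trans (mx_entry_le_norm _ x).
  by rewrite !mxE px sub0r normrN.
have g_conj x : (g x e p)^*%C = g (tau x) e p.
  by rewrite /g det_conj paired_eig_conj.
have c_conj x : (c x)^*%C = c (tau x).
  rewrite /c (rmorph_prod (@conjc R)) (reindex_inj (can_inj tauK)) /=.
  apply: eq_big => y; first by rewrite -(inj_eq (can_inj tauK)) tauK.
  by move=> _; rewrite (rmorphB (@conjc R)) /= !paired_eig_conj // tauK.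
(* The Newton correction at the fixed point. The equations [hp] kill its real part at unmarked
   vertices and its imaginary part at those that have a marked partner; conjugation symmetry, valid
   because [B e p] is real, supplies the rest. *)
pose k x := (c x)^-1 * g x e p.
have k_conj x : (k x)^*%C = k (tau x).
  by rewrite /k -c_conj -g_conj (rmorphM (@conjc R)) /= conjc_inv.
have Rek x : ~~ second x -> complex.Re (k x) = 0.
  move=> sx; have := hp x; rewrite /h (negbTE sx) /H raddfD /= Res //.
  by rewrite -[RHS]addr0 => /addrI.
have Imk x : second x -> complex.Im (k (tau x)) = 0.
  move=> sx; have := hp x; rewrite /h sx /H raddfD /= Ims //.
  by rewrite -[RHS]addr0 => /addrI.
have k0' x : ~~ second x -> k x = 0.
  move=> sx; apply/eqP; rewrite eq_complex Rek // eqxx /=.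
  (* At a fixed point of [tau] no equation controls the imaginary part, but [k x] equals its own
     conjugate there. *)
  have [xx|xx] := eqVneq (tau x) x.
    have := k_conj x; rewrite xx; case: (k x) => a b [] /= /eqP.
    by rewrite eq_sym -subr_eq0 opprK -mulr2n mulrn_eq0.
  by rewrite -[x]tauK Imk // second_tau // sx.
have k0 x : k x = 0.
  have [sx|] := boolP (second x); last exact: k0'.
  have xx := second_neq second_fix sx.
  by rewrite -[x]tauK -k_conj k0' ?conjc0 // second_tau // sx.
split.
  apply: eigenvalue_codom => // x.
  rewrite eigenvalue_det; have /eqP := k0 x.
  by rewrite mulf_eq0 invr_eq0 (negbTE (c_neq0 x)).
move=> i j ij; rewrite mxE (negbTE ij).
have [ji|ji] := eqVneq j (tau i).
  have ii : tau i != i by rewrite -ji eq_sym.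
  rewrite ji G_tau //; split=> // _.
  case: ifPn => si; first by rewrite oppr_eq0 p_second.
  by rewrite p_second // second_tau.
case: (G i j); first by rewrite gt_eqF.
by rewrite eqxx.
Qed.

End PairedSpectrum.

(** * Labelling the vertices by the matching, and the theorem *)

(** The complement of the image has [l] elements, and enumerating it extends [f]. With [f] listing
    the ends of matching edges, this labels all vertices of the graph. *)
Lemma extend_injection (T U : finType) (l : nat) (f : U -> T) :
  injective f -> #|T| = (#|U| + l)%N ->
  exists2 b : U + 'I_l -> T, bijective b & forall u, b (inl u) = f u.
Proof.
move=> f_inj cardT; pose S := [set x | x \notin codom f].
have cardS : l = #|S|.
  apply/eqP; rewrite -(eqn_add2l #|U|) -cardT -(card_codom f_inj).
  rewrite -(cardC (mem (codom f))) eqn_add2l; apply/eqP/eq_card => x.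
  by rewrite !inE.
pose e (j : 'I_l) : T := enum_val (cast_ord cardS j).
have eS j : e j \notin codom f.
  by have := enum_valP (cast_ord cardS j); rewrite inE.
exists (fun y => match y with inl u => f u | inr j => e j end) => //.
apply: inj_card_bij; last by rewrite card_sum card_ord cardT.
move=> [u|i] [w|j] //.
- by move=> /f_inj ->.
- by move=> fe; have := eS j; rewrite -fe codom_f.
- by move=> fe; have := eS i; rewrite fe codom_f.
- by move=> /enum_val_inj /cast_ord_inj ->.
Qed.

Theorem theorem3p1 (R : realType) (k l : nat) (hkl : (1 <= 2 * k + l)%N)
    (lambda mu : 'I_k -> R) (gamma : 'I_l -> R)
    (hmu : forall j, mu j != 0)
    (hdistinct : uniq (prescribed_spectrum lambda mu gamma))
    (G : rel 'I_(2 * k + l)) (hloopless : loopless G)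
    (hmatching : exists2 m : nat, (k <= m)%N & has_matching G m) :
  exists A : 'M[R]_(2 * k + l),
    has_eigenvalues A (prescribed_spectrum lambda mu gamma) /\
    is_graph_of G A.
Proof.
have [m km [u [v [uvG uv_disj]]]] := hmatching.
(* Only the first [k] of the [m] matching edges carry blocks; ends of further edges are treated as
   unmatched. *)
pose f (y : 'I_k + 'I_k) := match y with
  inl i => u (widen_ord km i) | inr i => v (widen_ord km i) end.
have uv_eq i j x : x \in [set u i; v i] -> x \in [set u j; v j] -> i = j.
  move=> xi xj; apply: contraTeq isT => /uv_disj /pred0P /(_ x) /=.
  by rewrite xi xj.
have uv i : u i != v i.
  by apply/eqP => uv; have [] := uvG i; rewrite uv hloopless.
have w_inj : injective (widen_ord km) by move=> i j [] /ord_inj.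
have f_inj : injective f.
  move=> [i|i] [j|j] /= fij.
  - by congr inl; apply/w_inj/(uv_eq _ _ (u (widen_ord km i)));
      rewrite ?fij !inE eqxx ?orbT.
  - have ij : widen_ord km i = widen_ord km j.
      by apply: (uv_eq _ _ (u (widen_ord km i))); rewrite ?fij !inE eqxx ?orbT.
    by have := uv (widen_ord km j); rewrite -fij ij eqxx.
  - have ij : widen_ord km i = widen_ord km j.
      by apply: (uv_eq _ _ (v (widen_ord km i))); rewrite ?fij !inE eqxx ?orbT.
    by have := uv (widen_ord km j); rewrite -fij ij eqxx.
  - by congr inr; apply/w_inj/(uv_eq _ _ (v (widen_ord km i)));
      rewrite ?fij !inE eqxx ?orbT.
have [||b [b' bK b'K] bf] := @extend_injection 'I_(2 * k + l) _ l f.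
- exact: f_inj.
- by rewrite card_sum !card_ord mul2n addnn.
(* The data are defined on labels and moved to vertices along [b]: real parts sit at the first ends,
   imaginary parts at the second ends, and real eigenvalues at the remaining vertices. *)
pose sw (y : 'I_k + 'I_k + 'I_l) : 'I_k + 'I_k + 'I_l := match y with
  | inl (inl i) => inl (inr i)
  | inl (inr i) => inl (inl i)
  | inr j => inr j end.
pose is_snd (y : 'I_k + 'I_k + 'I_l) :=
  if y is inl (inr _) then true else false.
pose par (y : 'I_k + 'I_k + 'I_l) : R := match y with
  | inl (inl i) => lambda i | inl (inr i) => mu i | inr j => gamma j end.
pose spec (y : 'I_k + 'I_k + 'I_l) : R[i] := match y with
  | inl (inl i) => (lambda i +i* mu i)%C
  | inl (inr i) => (lambda i -i* mu i)%C
  | inr j => (gamma j)%:C%C end.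
pose tau x := b (sw (b' x)).
pose second x : bool := is_snd (b' x).
pose p0 : 'rV[R]_(2 * k + l) := \row_x par (b' x).
have tauK : involutive tau.
  by move=> x; rewrite /tau bK -[RHS]b'K; case: (b' x) => [[i|i]|j].
have tau_b y : tau (b y) = b (sw y) by rewrite /tau bK.
have spec_mem : codom spec =i prescribed_spectrum lambda mu gamma.
  move=> z; rewrite !mem_cat; apply/codomP/or3P.
    move=> [[[i|i]|j] ->] /=; [apply: Or31|apply: Or32|apply: Or33];
    by apply/mapP; eexists; rewrite ?mem_enum.
  case=> /mapP [i _ ->].
  - by exists (inl (inl i)).
  - by exists (inl (inr i)).
  - by exists (inr i).
have spec_inj : injective spec.
  apply/injectiveP; rewrite /injectiveb /dinjectiveb -[map _ _]/(codom spec).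
  (* Two lists with the same members and the same length are duplicate-free together, which turns
     [hdistinct] into injectivity. *)
  rewrite (eq_uniq _ spec_mem) // size_codom !card_sum !size_cat.
  by rewrite !size_image addnA.
have eig_b y : paired_eig tau second p0 (b y) = spec y.
  rewrite /paired_eig tau_b /second bK (inj_eq (can_inj bK)) !mxE !bK.
  case: y => [[i|i]|j] /=; last by rewrite eqxx.
    by apply/eqP; rewrite eq_complex /=; apply/andP; split; apply/eqP; ring.
  by apply/eqP; rewrite eq_complex /=; apply/andP; split; apply/eqP; ring.
have eig_inj : injective (paired_eig tau second p0).
  by move=> x y; rewrite -[x]b'K -[y]b'K !eig_b => /spec_inj ->.
have [||||A [eigA GA]] :=
  @exists_paired_spectrum R _ tau second G tauK _ _ p0 _ eig_inj.
- move=> x; rewrite -[x]b'K tau_b /second !bK (inj_eq (can_inj bK)).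
  by case: (b' x) => [[i|i]|j] //=; rewrite eqxx.
- move=> x; rewrite -[x]b'K tau_b /second !bK => /(can_inj bK).
  by case: (b' x) => [[i|i]|j].
- move=> x; rewrite /second mxE; case: (b' x) => [[i|i]|j] // _; exact: hmu.
- move=> x; rewrite -[x]b'K tau_b (inj_eq (can_inj bK)).
  case: (b' x) => [[i|i]|j] /=; rewrite ?eqxx // !bf /= => _.
    by have [] := uvG (widen_ord km i).
  by have [] := uvG (widen_ord km i).
exists A; split=> // z.
have codomE : (z \in codom (paired_eig tau second p0)) = (z \in codom spec).
  apply/codomP/codomP => -[x ->]; first by exists (b' x); rewrite -eig_b b'K.
  by exists (b x).
by rewrite -spec_mem -codomE; exact: eigA.
Qed.
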